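(* Let $S$ be a unilateral weighted shift on a complex Hilbert space $\mathcal{H}$ with orthonormal basis $(e_n)_{n\ge 0}$ and bounded weight sequence $(\omega_n)_{n\ge 0}$ of positive real numbers, i.e. $Se_n=\omega_n e_{n+1}$ for all $n\ge 0$. If $S$ satisfies Dunford's condition $(C)$, then $r(S)=r_3(S)$.
   Context: $r(S)$ is the spectral radius of $S$. Put $\beta_0=1$ and $\beta_n=\omega_0\cdots\omega_{n-1}$ for $n>0$, and $r_3(S)=\limsup_{n\to\infty}\beta_n^{1/n}$. For a bounded linear operator $T$ on $\mathcal{H}$ and $x\in\mathcal{H}$, the local resolvent set $\rho_T(x)$ is the union of all open $U\subset\mathbb{C}$ for which there is an analytic $f:U\to\mathcal{H}$ with $(T-\lambda)f(\lambda)=x$ for all $\lambda\in U$; the local spectrum is $\sigma_T(x)=\mathbb{C}\setminus\rho_T(x)$. $T$ satisfies Dunford's condition $(C)$ if for every closed $F\subset\mathbb{C}$ the linear subspace $\mathcal{H}_T(F)=\{x\in\mathcal{H}:\sigma_T(x)\subset F\}$ is closed. *)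

(* Defs.v *)
From HB Require Import structures.
From mathcomp Require Import all_boot all_order all_algebra.
From mathcomp Require Import complex.
From mathcomp Require Import all_classical all_reals all_analysis.
Set Implicit Arguments.
Unset Strict Implicit.
Unset Printing Implicit Defensive.
Import Order.TTheory GRing.Theory Num.Theory.
Import numFieldNormedType.Exports.
Local Open Scope classical_set_scope.
Local Open Scope complex_scope.
Local Open Scope ring_scope.

(* The complex numbers are R[i] for R : realType.  Sets of complex numbers are
   typed over R[i]^o, the copy of R[i] that carries the topology.  The norm of
   a normed module over R[i] takes its (real) values in R[i]. *)

Section InnerProduct.
Variables (R : realType) (H : completeNormedModType R[i]).

(* H is a Hilbert space for ip : ip is a positive definite Hermitian form
   (linear on the left) which induces the complete norm of H. *)
Definition hilbert_product (ip : {dot H for @Num.conj R[i]}) : Prop :=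
  forall x, ip x x = `|x| ^+ 2.

Definition lin_span (e : nat -> H) : set H :=
  [set x | exists (n : nat) (c : nat -> R[i]), x = \sum_(i < n) c i *: e i].

Definition orthonormal_basis (ip : {dot H for @Num.conj R[i]})
    (e : nat -> H) : Prop :=
  (forall m n, ip (e m) (e n) = (m == n)%:R) /\ dense (lin_span e).

End InnerProduct.

Section Spectrum.
Variables (R : realType) (H : completeNormedModType R[i]).
Implicit Types (T : {linear H -> H}) (x : H).

Definition bounded_operator T : Prop :=
  exists M : R, forall x, `|T x| <= M%:C * `|x|.

Definition resolvent_set T : set R[i]^o :=
  [set l | exists G : {linear H -> H}, bounded_operator G /\
     forall x, G (T x - l *: x) = x /\ T (G x) - l *: G x = x].

Definition spectrum T : set R[i]^o := ~` resolvent_set T.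

Definition spectral_radius T : \bar R :=
  ereal_sup [set (complex.Re `|l|)%:E | l in spectrum T].

(* derivable over the scalar field R[i], i.e., complex differentiability in
   the norm of H; f is only relevant on U, its values elsewhere are junk *)
Definition analytic_on (U : set R[i]^o) (f : R[i]^o -> H) : Prop :=
  forall l, U l -> derivable f l 1.

Definition local_resolvent_set T x : set R[i]^o :=
  \bigcup_(U in [set U : set R[i]^o | open U /\
      exists f : R[i]^o -> H, analytic_on U f /\
        forall l, U l -> T (f l) - l *: f l = x]) U.

Definition local_spectrum T x : set R[i]^o := ~` local_resolvent_set T x.

Definition local_spectral_subspace T (F : set R[i]^o) : set H :=
  [set x | local_spectrum T x `<=` F].

Definition dunford_condition_C T : Prop :=
  forall F : set R[i]^o, closed F -> closed (local_spectral_subspace T F).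

End Spectrum.

Section WeightedShift.
Variable R : realType.

Definition weight_prod (w : nat -> R) (n : nat) : R := \prod_(i < n) w i.

(* the term n = 0, where 0^-1 = 0, does not affect the upper limit *)
Definition r3 (w : nat -> R) : \bar R :=
  limn_esup (fun n => (weight_prod w n `^ n%:R^-1)%:E).

Definition weighted_shift (H : completeNormedModType R[i]) (e : nat -> H)
    (w : nat -> R) (S : {linear H -> H}) : Prop :=
  bounded_operator S /\ forall n, S (e n) = (w n)%:C *: e n.+1.

End WeightedShift.

(* Main.v *)
Require Import Defs.
From HB Require Import structures.
From mathcomp Require Import all_boot all_order all_algebra.
From mathcomp Require Import complex.
From mathcomp Require Import all_classical all_reals all_analysis.
From mathcomp Require Import ring lra.
Import Order.TTheory GRing.Theory Num.Theory.
Import numFieldNormedType.Exports.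
Set Implicit Arguments.
Unset Strict Implicit.
Unset Printing Implicit Defensive.
Local Open Scope classical_set_scope.
Local Open Scope complex_scope.
Local Open Scope ring_scope.

(** Let [S] be the shift, [b_n = weight_prod w n] the products of its weights.

    Upper bound. The orbit of a basis vector is [S^k e_n = (b_(n+k) / b_n) e_(n+k)],
    so for [rho > r3 w] the orbit of every finite combination [x] of basis vectors
    satisfies [|S^k x| <= D rho^k]. For [|l| > rho] the equation [(S - l) z = x] is
    then solved by the Neumann series, analytically in [l]
    ([local_spectrum_geometric_orbit]), and the local spectrum of [x] lies in the
    disk of radius [rho]. The vectors with this property form a closed set by
    condition (C), and a dense one, hence all of [H]: for [|l| > r3 w] the operator
    [S - l] is onto. It is injective, since a weighted shift has no nonzero
    eigenvalue ([shift_no_eigenvalue]), and a bijective [S - l] has a bounded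
    inverse ([shift_resolvent_set], by a Baire argument). So no such [l] belongs to
    the spectrum ([dunford_resolvent_set]).

    Lower bound. If [t > 0] is in the resolvent set, then solving
    [(S - t) x = e_0] coordinate by coordinate gives [x_n = - b_n / t^(n+1)]. As
    the [x_n] are bounded, the upper limit of [b_n^(1/n)] is at most [t]
    ([resolvent_weight_prod], [weight_prod_le_r3]). This holds for every [t]
    beyond the spectral radius, which is nonnegative because 0 is in the
    spectrum ([shift_spectrum0]). *)

(** * The real value of the norm *)
Section RealNorm.
Variables (R : realType) (V : normedModType R[i]).
Implicit Types x y : V.

(** The norm of a normed module over [R[i]] lies in the partially ordered
    field [R[i]]. All its values are real, and estimates are carried out on
    this real part, where the order is total. *)
Definition rnorm x : R := complex.Re `|x|.

Lemma rnormE x : `|x| = (rnorm x)%:C.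
Proof. by rewrite /rnorm RRe_real ?normr_real. Qed.

Lemma rnorm_ge0 x : 0 <= rnorm x.
Proof. by rewrite -lecR -rnormE normr_ge0. Qed.

Lemma ler_rnormD x y : rnorm (x + y) <= rnorm x + rnorm y.
Proof. by rewrite -lecR rmorphD /= -!rnormE ler_normD. Qed.

Lemma rnormN x : rnorm (- x) = rnorm x.
Proof. by rewrite /rnorm normrN. Qed.

Lemma rnormB x y : rnorm (x - y) = rnorm (y - x).
Proof. by rewrite /rnorm distrC. Qed.

Lemma rnorm0 : rnorm 0 = 0.
Proof. by rewrite /rnorm normr0. Qed.

Lemma rnorm0_eq0 x : rnorm x = 0 -> x = 0.
Proof. by move=> x0; apply/eqP; rewrite -normr_eq0 rnormE x0. Qed.

Lemma ler_rnorm_sum (u : nat -> V) n :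
  rnorm (\sum_(i < n) u i) <= \sum_(i < n) rnorm (u i).
Proof.
elim: n => [|n IH]; first by rewrite !big_ord0 rnorm0.
by rewrite !big_ord_recr /=; apply: le_trans (ler_rnormD _ _) _; rewrite lerD2r.
Qed.

Lemma complex_gt0 (c : R[i]) : 0 < c -> c = (complex.Re c)%:C /\ 0 < complex.Re c.
Proof.
move=> c0; have cR : c = (complex.Re c)%:C by rewrite RRe_real ?gtr0_real.
by split=> //; rewrite -ltcR -cR.
Qed.

Lemma cvg_rnormP {T : Type} {F : set_system T} {FF : Filter F} (f : T -> V) l :
  f @ F --> l <-> forall e : R, 0 < e -> \forall x \near F, rnorm (l - f x) < e.
Proof.
split=> [/cvgrPdist_lt fl e e0|fl].
  have := fl e%:C; rewrite ltcR => /(_ e0).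
  by apply: filterS => x; rewrite rnormE ltcR.
apply/cvgrPdist_lt => e /complex_gt0[-> e0].
by apply: filterS (fl _ e0) => x; rewrite rnormE ltcR.
Qed.

Lemma nbhs_rnormP x (A : set V) :
  nbhs x A <-> exists2 e : R, 0 < e & forall y, rnorm (x - y) < e -> A y.
Proof.
split=> [/nbhs_ballP[e /= /complex_gt0[eE e0]]|[e e0 eA]].
  rewrite eE -ball_normE => eA; exists (complex.Re e) => // y xy.
  by apply: eA; rewrite /= rnormE ltcR.
apply/nbhs_ballP; exists e%:C; first by rewrite /= ltcR.
by rewrite -ball_normE => y; rewrite /= rnormE ltcR => /eA.
Qed.

End RealNorm.

Lemma rnormZ (R : realType) (V : normedModType R[i]) (a : R[i]^o) (x : V) :
  rnorm (a *: x) = rnorm a * rnorm x.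
Proof.
apply: complexI; rewrite -rnormE normrZ (rnormE x).
by have -> : `|a : R[i]| = (rnorm a)%:C := rnormE a; rewrite -rmorphM.
Qed.

Lemma rnorm_real (R : realType) (a : R) : 0 <= a -> rnorm (a%:C : R[i]^o) = a.
Proof. by move=> a0; rewrite /rnorm ger0_norm ?ler0c. Qed.

Section Lipschitz.
Variables (R : realType) (V W : normedModType R[i]).

Lemma lipschitz_continuous_rnorm (f : V -> W) (M : R) :
  (forall x y, rnorm (f x - f y) <= M * rnorm (x - y)) -> continuous f.
Proof.
move=> fM x; apply/cvg_rnormP => e e0.
have K0 : 0 < `|M| + 1 by rewrite ltr_wpDl.
apply/nbhs_rnormP; exists (e / (`|M| + 1)); first by rewrite divr_gt0.
move=> y; rewrite ltr_pdivlMr// => xy; apply: le_lt_trans (fM _ _) (le_lt_trans _ xy).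
rewrite mulrC ler_wpM2l ?rnorm_ge0//.
by rewrite (le_trans (ler_norm _))// lerDl.
Qed.

End Lipschitz.

Lemma rnorm_continuous (R : realType) (V : normedModType R[i]) : continuous (@rnorm R V).
Proof.
move=> x; apply/cvgrPdist_lt => d d0; apply/nbhs_rnormP; exists d => // y xy.
rewrite ltr_norml; have := ler_rnormD (x - y) y; have := ler_rnormD (y - x) x.
by rewrite !subrK (rnormB y); lra.
Qed.

Lemma closed_rnorm_le (R : realType) (T : topologicalType) (V W : normedModType R[i])
  (f : T -> V) (g : T -> W) (M : R) : continuous f -> continuous g ->
  closed [set x | rnorm (f x) <= M * rnorm (g x)].
Proof.
move=> cf cg.
pose h x := rnorm (f x) - M * rnorm (g x).
rewrite (_ : [set x | _] = h @^-1` [set r | r <= 0]).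
  apply: closed_comp; last exact: closed_le.
  move=> x _; apply: cvgB; last apply: cvgMr.
    by apply: continuous_comp; [exact: cf|exact: rnorm_continuous].
  by apply: continuous_comp; [exact: cg|exact: rnorm_continuous].
by apply/seteqP; split=> x /=; rewrite subr_le0.
Qed.

(** * Convergence in the complete space *)
Section Complete.
Variables (R : realType) (H : completeNormedModType R[i]).
Implicit Types x y : H.

(** The bound on [u m - u n] passes to the limit, so that a single statement
    gives both the existence of the limit and the rate of convergence. *)
Lemma cvg_of_tail_bound (u : nat -> H) (r : nat -> R) :
  r @ \oo --> 0 -> (forall n m, (n <= m)%N -> rnorm (u m - u n) <= r n) ->
  exists l, u @ \oo --> l /\ forall n, rnorm (l - u n) <= r n.
Proof.
move=> r0 ur.
have : cvg (u @ \oo).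
  apply: cauchy_cvg; apply: cauchy_exP => e /complex_gt0[eE e0].
  move/cvgrPdist_lt/(_ _ e0): r0 => [N _ rN].
  exists (u N), N => // m /= Nm.
  rewrite -ball_normE /= eE rnormE ltcR rnormB (le_lt_trans (ur _ _ Nm))//.
  by apply: le_lt_trans (rN N (leqnn N)); rewrite sub0r normrN ler_norm.
move=> /cvg_ex[/= l ul]; exists l; split=> // n.
rewrite leNgt; apply/negP => rl.
have e0 : 0 < rnorm (l - u n) - r n by rewrite subr_gt0.
have [N _ /(_ (maxn N n) (leq_maxl _ _)) lm] := (cvg_rnormP _ _).1 ul _ e0.
have := ler_rnormD (l - u (maxn N n)) (u (maxn N n) - u n).
rewrite addrA subrK; have := ur _ _ (leq_maxr N n); lra.
Qed.

Lemma ler_geometric_sum (q : R) n : 0 <= q -> q < 1 -> \sum_(i < n) q ^+ i <= (1 - q)^-1.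
Proof.
move=> q0 q1; rewrite -[leRHS]mul1r ler_pdivlMr ?subr_gt0// mulrC -opprB mulNr -subrX1.
by rewrite opprB gerBl exprn_ge0.
Qed.

Lemma geometric_series_cvg (u : nat -> H) (C q : R) : 0 <= q -> q < 1 ->
  (forall n, rnorm (u n) <= C * q ^+ n) ->
  exists l, (fun n => \sum_(i < n) u i) @ \oo --> l /\ rnorm l <= C / (1 - q).
Proof.
move=> q0 q1 uC.
have C0 : 0 <= C by have := uC 0%N; rewrite expr0 mulr1; exact/le_trans/rnorm_ge0.
have q1' : 0 <= 1 - q by lra.
have [] := @cvg_of_tail_bound (fun n => \sum_(i < n) u i) (fun n => C / (1 - q) * q ^+ n).
- by apply: cvg_geometric; rewrite ger0_norm.
- move=> n m nm; rewrite -(subnKC nm); move: (m - n)%N => k.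
  rewrite big_split_ord /= [X in rnorm (X - _)]addrC addrK.
  rewrite (le_trans (ler_rnorm_sum (fun i => u (n + i)%N) _))//.
  apply: (@le_trans _ _ (\sum_(i < k) C * q ^+ n * q ^+ i)).
    by apply: ler_sum => i _; rewrite -mulrA -exprD.
  rewrite -mulr_sumr [leRHS]mulrAC ler_wpM2l ?mulr_ge0 ?exprn_ge0//.
  exact: ler_geometric_sum.
- move=> l [ul lC]; exists l; split=> //.
  by have := lC 0%N; rewrite big_ord0 subr0 expr0 mulr1.
Qed.

End Complete.

(** The form in which density is used: a closed condition that holds on a
    dense set holds everywhere. *)
Lemma dense_closed_setT {T : topologicalType} (D A : set T) :
  dense D -> D `<=` A -> closed A -> forall x : T, A x.
Proof.
move=> dD DA cA x; apply: contrapT => nAx.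
have [y [nAy Dy]] := dD (~` A) (ex_intro _ x nAx) (closed_openC cA).
exact: nAy (DA _ Dy).
Qed.

(** * Bounded operators and vectors with a geometric orbit *)
Section Operator.
Variables (R : realType) (H : completeNormedModType R[i]).
Implicit Types (T G : {linear H -> H}) (x y : H).

Lemma bounded_operatorP T :
  bounded_operator T <-> exists M : R, forall x, rnorm (T x) <= M * rnorm x.
Proof.
split=> -[M TM]; exists M => x.
  by have := TM x; rewrite !rnormE -rmorphM lecR.
by rewrite !rnormE -rmorphM lecR.
Qed.

Lemma bounded_operator_continuous T : bounded_operator T -> continuous T.
Proof.
move=> /bounded_operatorP[M TM]; apply: (@lipschitz_continuous_rnorm _ _ _ _ M) => x y.
by rewrite -linearB.
Qed.

(** A Baire category argument. If [G] is unbounded then it is unbounded on every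
    ball, and the sets where [|G y| > n] are open by hypothesis; so there are
    nested balls, of radii tending to 0, with [|G y| > n] on the [n]-th one.
    At their common point [G] would have no finite value. *)
Lemma closed_sublevel_bounded G :
  (forall M : R, closed [set y | rnorm (G y) <= M]) -> bounded_operator G.
Proof.
move=> clG; apply: contrapT => /bounded_operatorP nG.
have unb M : exists y, M * rnorm y < rnorm (G y).
  apply: contrapT => ny; apply: nG; exists M => x.
  by rewrite leNgt; apply/negP => Mx; apply: ny; exists x.
(* If |G| <= M on the ball of centre x and radius r, then |G (c y)| <= 2 M for
   |c y| = r / 2, which bounds |G y| by (4 M / r) |y|. *)
have big (x : H) (r M : R) : 0 < r -> exists y, rnorm (y - x) < r /\ M < rnorm (G y).
  move=> r0; apply: contrapT => nM.
  have GM y : rnorm (y - x) < r -> rnorm (G y) <= M.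
    by move=> yx; rewrite leNgt; apply/negP => My; apply: nM; exists y.
  have M0 : 0 <= M by apply: le_trans (GM x _); rewrite ?subrr ?rnorm0 ?rnorm_ge0.
  have [y] := unb (4 * M / r).
  have [y0|y0] := eqVneq (rnorm y) 0.
    by rewrite (rnorm0_eq0 y0) linear0 rnorm0 mulr0 ltxx.
  have {}y0 : 0 < rnorm y by rewrite lt_def y0 rnorm_ge0.
  pose c : R := r / (2 * rnorm y).
  have c0 : 0 < c by rewrite divr_gt0// mulr_gt0.
  have cn : rnorm (c%:C : R[i]^o) = c.
    by rewrite /rnorm gtr0_norm// ltcR.
  have yc : rnorm (x + c%:C *: y - x) < r.
    rewrite addrC addKr rnormZ cn /c invfM mulrA mulfVK ?gt_eqF// ltr_pdivrMr//.
    lra.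
  have := GM _ yc; rewrite linearD linearZ /= => Gxy; apply/negP; rewrite -leNgt.
  have : rnorm (c%:C *: G y) <= 2 * M.
    rewrite -(addKr (G x) (c%:C *: G y)).
    have := ler_rnormD (- G x) (G x + c%:C *: G y).
    have := GM x; rewrite rnormN subrr rnorm0 => /(_ r0); lra.
  rewrite rnormZ cn /c mulrAC ler_pdivrMr ?mulr_gt0// => H1.
  by rewrite mulrAC ler_pdivlMr//; lra.
have step (p : H * R) (n : nat) : exists q : H * R, 0 < p.2 ->
   [/\ 0 < q.2, q.2 <= p.2 / 2, rnorm (q.1 - p.1) <= p.2 / 2 &
     forall y, rnorm (y - q.1) <= q.2 -> n%:R < rnorm (G y)].
  have [p0|p0] := ltP 0 p.2; last by exists p; rewrite ltNge p0.
  have [y [yp ny]] := big p.1 (p.2 / 2) n%:R (divr_gt0 p0 (ltr0Sn _ 1)).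
  have : nbhs y (~` [set y | rnorm (G y) <= n%:R]).
    apply: open_nbhs_nbhs; split; first exact/closed_openC/clG.
    by move=> /=; apply/negP; rewrite -ltNge.
  move=> /nbhs_rnormP[e e0 eG].
  exists (y, Num.min (e / 2) (p.2 / 2)) => _ /=; split.
  - by rewrite lt_min !divr_gt0.
  - by rewrite ge_min lexx orbT.
  - exact: ltW.
  - move=> z zy; rewrite ltNge; apply/negP; apply: eG.
    rewrite rnormB (le_lt_trans zy)// gt_min; apply/orP; left; lra.
(* Guarding the conclusion of step by 0 < p.2 makes it total, so that it can be
   iterated from the unit ball at 0. *)
have [f fP] := choice (fun pn : (H * R) * nat => step pn.1 pn.2).
pose fix s n := if n is m.+1 then f (s m, m) else (0, 1).
pose a n := (s n).1; pose r n := (s n).2.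
have sP n : 0 < r n ->
   [/\ 0 < r n.+1, r n.+1 <= r n / 2, rnorm (a n.+1 - a n) <= r n / 2 &
     forall y, rnorm (y - a n.+1) <= r n.+1 -> n%:R < rnorm (G y)].
  exact: fP (s n, n).
have r0 n : 0 < r n by elim: n => [|n IH]; [exact: ltr01|case: (sP n IH)].
have rle n : r n <= 1 * (2^-1) ^+ n.
  elim: n => [|n IH]; first by rewrite mulr1.
  have [_ + _ _] := sP n (r0 n); rewrite exprSr mulrA; lra.
have anm n m : (n <= m)%N -> rnorm (a m - a n) <= r n - r m.
  elim: m => [|m IH]; first by rewrite leqn0 => /eqP->; rewrite !subrr rnorm0.
  rewrite leq_eqVlt => /orP[/eqP->|/IH nm]; first by rewrite !subrr rnorm0.
  have := ler_rnormD (a m.+1 - a m) (a m - a n); rewrite addrA subrK.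
  have [_ ? ? _] := sP m (r0 m); lra.
have [] := @cvg_of_tail_bound _ _ a r.
- apply: (@squeeze_cvgr _ _ _ _ (cst 0) (geometric 1 2^-1)).
  + by apply: nearW => n; apply/andP; split; [exact: ltW|exact: rle].
  + exact: cvg_cst.
  + by apply: cvg_geometric; rewrite ger0_norm ?invr_ge0// invf_lt1// ltr1n.
- by move=> n m /anm; have := r0 m; lra.
move=> l [_ la].
have Gl n : n%:R < rnorm (G l) by have [_ _ _] := sP n (r0 n); apply; exact: la.
have := Gl (Num.truncn (rnorm (G l))).+1.
by rewrite ltNge ltW// truncnS_gt.
Qed.

(** The Neumann series [- \sum_k l ^- k.+1 *: T^k x] converges as soon as the
    orbit of the single vector [x] grows slower than [|l|^k], whatever the
    spectrum of [T] is. *)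
Lemma geometric_orbit_resolvent T x (C rho : R) (l : R[i]^o) :
  bounded_operator T -> 0 <= rho -> rho < rnorm l ->
  (forall k, rnorm (iter k T x) <= C * rho ^+ k) ->
  exists2 z, T z - l *: z = x & rnorm z <= C / (rnorm l - rho).
Proof.
move=> bT rho0 rhol TC.
have l0 : 0 < rnorm l by exact: le_lt_trans rhol.
have lneq0 : l != 0 by apply: contraTneq l0 => ->; rewrite rnorm0 ltxx.
have nlV n : rnorm (l ^- n : R[i]^o) = (rnorm l) ^- n.
  rewrite /rnorm normfV normrX rnormE -rmorphXn -fmorphV.
  by [].
pose u k := - (l ^- k.+1 *: iter k T x).
have uC k : rnorm (u k) <= C / rnorm l * (rho / rnorm l) ^+ k.
  rewrite rnormN rnormZ nlV exprMn exprVn [leRHS]mulrACA -invfM -exprS mulrC.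
  by rewrite ler_wpM2r// invr_ge0 exprn_ge0 ?ltW.
have q0 : 0 <= rho / rnorm l by rewrite divr_ge0// ltW.
have q1 : rho / rnorm l < 1 by rewrite ltr_pdivrMr ?mul1r.
have [z [uz zC]] := geometric_series_cvg q0 q1 uC.
exists z; last first.
  rewrite (le_trans zC)// -mulrA -invfM mulrBr mulr1 mulrCA divff ?mulr1 ?gt_eqF//.
(* The sum telescopes: the n-th partial sum solves the equation up to an error
   that is a multiple of T^n x. *)
have sE n : T (\sum_(i < n) u i) - l *: \sum_(i < n) u i = x - l ^- n *: iter n T x.
  elim: n => [|n IH]; first by rewrite !big_ord0 linear0 scaler0 expr0 invr1 scale1r !subrr.
  have Tu : T (u n) - l *: u n = l ^- n *: iter n T x - l ^- n.+1 *: iter n.+1 T x.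
    have le : l * l ^- n.+1 = l ^- n by rewrite exprS invfM mulrA divff// mul1r.
    have TZ a (v : H) : T (a *: v) = a *: T v by exact: linearZ_LR.
    have TN (v : H) : T (- v) = - T v by exact: raddfN.
    by rewrite -le -scalerA /u TN TZ scalerN opprK addrC.
  by rewrite !big_ord_recr [T (_ + _)]linearD scalerDr opprD addrACA IH Tu addrA subrK.
have Tz : (fun n => T (\sum_(i < n) u i) - l *: \sum_(i < n) u i) @ \oo --> T z - l *: z.
  apply: cvgB; last by apply: cvgZr.
  by apply: continuous_cvg => //; exact: bounded_operator_continuous.
apply: (cvg_unique _ Tz); first exact: norm_hausdorff.
rewrite (funext sE).
suff l0T : (fun n => l ^- n *: iter n T x) @ \oo --> (0 : H).
  by have := cvgB (cvg_cst x) l0T; rewrite subr0; apply.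
apply/cvg_rnormP => e e0.
have : geometric C (rho / rnorm l) @ \oo --> 0 by apply: cvg_geometric; rewrite ger0_norm.
move=> /cvgrPdist_lt/(_ _ e0); apply: filterS => n /=; rewrite !sub0r normrN => Cn.
rewrite rnormN rnormZ nlV mulrC; apply: le_lt_trans Cn.
apply: le_trans (ler_norm _); rewrite exprMn exprVn mulrA ler_wpM2r//.
by rewrite invr_ge0 exprn_ge0 ?ltW.
Qed.

End Operator.

(** * Local spectra *)
Lemma closed_disk (R : realType) (r : R) :
  closed [set l : R[i]^o | rnorm l <= r].
Proof.
rewrite (_ : [set l : R[i]^o | _] = @rnorm R R[i]^o @^-1` [set x | x <= r])//.
by apply: closed_comp; [move=> x _; exact: rnorm_continuous|exact: closed_le].
Qed.

Section LocalSpectrum.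
Variables (R : realType) (H : completeNormedModType R[i]).
Implicit Types (T G : {linear H -> H}) (x y : H).

(** A bound on the local spectral radius of [x]. Outside the disk the solution
    [F x l] of [(T - l) z = x] exists by [geometric_orbit_resolvent] and is unique
    because [T] has no eigenvalue there. Instead of differentiating the series,
    one uses that [F x l] has again a geometric orbit, so that uniqueness yields
    the resolvent identity [F x m - F x l = (m - l) *: F (F x l) m]. It shows in
    turn that [F x] is continuous and that its derivative at [l] is
    [F (F x l) l]. *)
Lemma local_spectrum_geometric_orbit T x (C rho : R) :
  bounded_operator T -> 0 <= rho ->
  (forall (l : R[i]^o) y, l != 0 -> T y = l *: y -> y = 0) ->
  (forall k, rnorm (iter k T x) <= C * rho ^+ k) ->
  local_spectrum T x `<=` [set l | rnorm l <= rho].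
Proof.
move=> bT rho0 injT TC.
have TZ a (v : H) : T (a *: v) = a *: T v by exact: linearZ_LR.
have TB (v w : H) : T (v - w) = T v - T w by exact: linearB.
pose U : set R[i]^o := ~` [set l | rnorm l <= rho].
have oU : open U by exact/closed_openC/closed_disk.
have UE l : U l -> rho < rnorm l by move=> /negP; rewrite -ltNge.
have Uneq0 l : U l -> l != 0.
  by move=> /UE; apply: contraTneq => ->; rewrite rnorm0 -leNgt.
have injU l y z : U l -> T y - l *: y = T z - l *: z -> y = z.
  move=> Ul yz; apply/eqP; rewrite -subr_eq0; apply/eqP/(injT l _ (Uneq0 _ Ul)).
  apply/subr0_eq; rewrite TB scalerBr opprD addrACA -opprD yz.
  exact: subrr.
pose F (y : H) (l : R[i]^o) : H := xget 0 [set z | T z - l *: z = y].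
have orb_iter y D n : (forall k, rnorm (iter k T y) <= D * rho ^+ k) ->
    forall k, rnorm (iter k T (iter n T y)) <= D * rho ^+ n * rho ^+ k.
  by move=> yD k; rewrite -iterD -mulrA -exprD addnC; exact: yD.
have FE y D l : U l -> (forall k, rnorm (iter k T y) <= D * rho ^+ k) ->
    T (F y l) - l *: F y l = y.
  move=> Ul yD; have [z zE _] := geometric_orbit_resolvent bT rho0 (UE _ Ul) yD.
  by rewrite /F; case: xgetP => [w -> //|/(_ z)].
(* By uniqueness T^k (F y l) is the solution for the right-hand side T^k y, to
   which the norm estimate on solutions applies. *)
have FC y D l : U l -> (forall k, rnorm (iter k T y) <= D * rho ^+ k) ->
    forall k, rnorm (iter k T (F y l)) <= D / (rnorm l - rho) * rho ^+ k.
  move=> Ul yD k.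
  have [z zE zC] := geometric_orbit_resolvent bT rho0 (UE _ Ul) (orb_iter y D k yD).
  suff -> : iter k T (F y l) = z by rewrite mulrAC.
  apply: (injU l) => //; rewrite zE -[in RHS](FE y D l)//.
  elim: k {z zE zC} => //= k <-.
  by rewrite TB TZ.
have FB y D l m : U l -> U m -> (forall k, rnorm (iter k T y) <= D * rho ^+ k) ->
    F y m - F y l = (m - l) *: F (F y l) m.
  move=> Ul Um yD; apply: (injU m) => //.
  have lm : m *: ((m - l) *: F (F y l) m) = (m - l) *: (m *: F (F y l) m).
    by rewrite !scalerA mulrC.
  rewrite TZ lm -scalerBr (FE _ _ _ Um (FC _ _ _ Ul yD)).
  have FlE : T (F y l) - l *: F y l = y := FE _ _ _ Ul yD.
  rewrite TB scalerBr opprD addrACA -opprD (FE _ _ _ Um yD) -[X in X - _]FlE.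
  by rewrite opprD opprK addrACA subrr add0r scalerBl addrC.
move=> l; apply: contra_notP => Ul; exists U => //; split=> //.
exists (F x); split; last by move=> m Um; exact: FE TC.
move=> {Ul} {}l Ul.
apply/cvg_ex; exists (F (F x l) l); apply/cvg_rnormP => e e0.
pose d := (rnorm l - rho) / 2.
have d0 : 0 < d by rewrite divr_gt0// subr_gt0 UE.
have shiftU (h : R[i]^o) : rnorm h < d -> U (h + l) /\ d <= rnorm (h + l) - rho.
  move=> hd; have dl : d <= rnorm (h + l) - rho.
    have := ler_rnormD (h + l) (- h); rewrite [h + l]addrC addrK rnormN.
    by move: hd; rewrite /d; lra.
  by split=> //; apply/negP; rewrite -ltNge -subr_gt0 (lt_le_trans d0).
have [D1 x1] : exists D, forall k, rnorm (iter k T (F x l)) <= D * rho ^+ k.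
  by eexists; exact: FC Ul TC.
have [D2 x2] : exists D, forall k, rnorm (iter k T (F (F x l) l)) <= D * rho ^+ k.
  by eexists; exact: FC Ul x1.
have D20 : 0 <= D2 by have := x2 0%N; rewrite expr0 mulr1; exact/le_trans/rnorm_ge0.
(* F z (h + l) - F z l = h *: F (F z l) (h + l) for z = F x l, and the last
   factor has norm at most D2 / d when |h| < d. *)
pose r := Num.min d (e * d / (D2 + 1)).
have D21 : 0 < D2 + 1 by lra.
have r0 : 0 < r by rewrite /r lt_min d0 divr_gt0 // mulr_gt0.
apply/nbhs_rnormP; exists r => // h; rewrite sub0r rnormN lt_min => /andP[hd he] h0.
have [Uhl dhl] := shiftU h hd.
rewrite /= [h%:A]mulr1 (FB _ _ _ _ Ul Uhl TC) addrK scalerA mulVf// scale1r.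
rewrite rnormB (FB _ _ _ _ Ul Uhl x1) addrK rnormZ.
have := FC _ _ _ Uhl x2 0%N; rewrite expr0 mulr1 /= => Fh.
have {}Fh : rnorm (F (F (F x l) l) (h + l)) <= D2 / d.
  by rewrite (le_trans Fh)// ler_wpM2l// lef_pV2 ?posrE ?(lt_le_trans d0).
apply: le_lt_trans (ler_wpM2l (rnorm_ge0 _) Fh) _.
rewrite mulrA ltr_pdivrMr//; move: he; rewrite ltr_pdivlMr//.
by apply: le_lt_trans; rewrite ler_wpM2l ?rnorm_ge0// lerDl.
Qed.

End LocalSpectrum.

(** * Coordinates in the orthonormal basis *)
Section HilbertShift.
Variables (R : realType) (H : completeNormedModType R[i]).
Variables (ip : {dot H for @Num.conj R[i]}) (Hip : hilbert_product ip).
Implicit Types x y : H.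

Lemma lin_span_ind (e : nat -> H) (P : set H) :
  P 0 -> (forall a x y, P x -> P y -> P (a *: x + y)) -> (forall n, P (e n)) ->
  lin_span e `<=` P.
Proof.
move=> P0 PD Pe x [n [c ->]]; elim: n => [|n IH]; first by rewrite big_ord0.
by rewrite big_ord_recr /= addrC; apply: PD.
Qed.

Lemma closed_zeros (f : H -> R[i]^o) : continuous f -> closed [set x | f x = 0].
Proof.
move=> cf; rewrite (_ : [set x | _] = f @^-1` [set 0])//.
apply: closed_comp; first by move=> x _; exact: cf.
exact/accessible_closed_set1/hausdorff_accessible/norm_hausdorff.
Qed.

Lemma dot_rnormE x : ip x x = (rnorm x ^+ 2)%:C.
Proof. by rewrite Hip rnormE rmorphXn. Qed.

(** Pythagoras for the orthogonal projection of [x] onto the line of [y]. *)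
Lemma cauchy_schwarz x y : rnorm (ip x y : R[i]^o) <= rnorm x * rnorm y.
Proof.
have [y0|yn0] := eqVneq (rnorm y) 0.
  by rewrite (rnorm0_eq0 y0) linear0r !rnorm0 mulr0.
have y0 : 0 < rnorm y by rewrite lt_def yn0 rnorm_ge0.
have ipy0 : ip y y != 0 by apply: lt0r_neq0; rewrite dot_rnormE ltcR exprn_gt0.
pose a : R[i]^o := ip x y / ip y y; pose u := x - a *: y.
have uy : ip u y = 0 by rewrite linearBl linearZl_LR /= divfK ?subrr.
have xE : rnorm x ^+ 2 = rnorm u ^+ 2 + rnorm (a *: y) ^+ 2.
  apply: complexI; rewrite rmorphD /= -!dot_rnormE -hnormDd ?subrK//.
  by rewrite linearZr_LR /= uy mulr0.
have : rnorm (a *: y) <= rnorm x.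
  by rewrite -(@ler_sqr _ (rnorm _)) ?nnegrE ?rnorm_ge0// xE lerDr sqr_ge0.
rewrite rnormZ.
have -> : rnorm a = rnorm (ip x y : R[i]^o) / rnorm y ^+ 2.
  apply: complexI; rewrite -rnormE normf_div rnormE rmorphM /=.
  by rewrite dot_rnormE ger0_norm ?fmorphV// ler0c sqr_ge0.
by rewrite expr2 invfM mulrA mulfVK// ler_pdivrMr.
Qed.

Lemma ip_continuous_l y : continuous (fun x => ip x y : R[i]^o).
Proof.
apply: (@lipschitz_continuous_rnorm _ _ _ _ (rnorm y)) => x z.
by rewrite -linearBl mulrC cauchy_schwarz.
Qed.

Lemma ip_continuous_r x : continuous (fun y => ip x y : R[i]^o).
Proof.
apply: (@lipschitz_continuous_rnorm _ _ _ _ (rnorm x)) => y z.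
by rewrite -linearBr cauchy_schwarz.
Qed.

Variables (e : nat -> H) (He : orthonormal_basis ip e).

Lemma coord_inj x : (forall n, ip x (e n) = 0) -> x = 0.
Proof.
move=> x0; apply: rnorm0_eq0.
have : ip x x = 0.
  apply: (dense_closed_setT He.2 _ (closed_zeros (@ip_continuous_r x))).
  apply: lin_span_ind => //=; first exact: linear0r.
  by move=> a y z y0 z0; rewrite linearDr linearZr_LR /= y0 z0 mulr0 addr0.
by rewrite dot_rnormE => /complexI/eqP; rewrite expf_eq0 => /eqP.
Qed.

Variables (w : nat -> R) (w_gt0 : forall n, 0 < w n).
Variables (S : {linear H -> H}) (HS : weighted_shift e w S).

(** The formulas for [S] on the basis extend from its span to the whole space
    because both sides are continuous. *)
Lemma shift_coord0 x : ip (S x) (e 0) = 0.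
Proof.
apply: (dense_closed_setT He.2 (A := [set x | ip (S x) (e 0) = 0])).
  apply: lin_span_ind => /= [|a y z y0 z0|n].
  - by rewrite linear0 linear0l.
  - by rewrite linearP linearDl linearZl_LR /= y0 z0 mulr0 addr0.
  - by rewrite HS.2 linearZl_LR /= He.1 mulr0.
apply: closed_zeros => y.
apply: (@continuous_comp _ _ _ S (fun z => ip z (e 0) : R[i]^o)).
  exact: bounded_operator_continuous HS.1 _.
exact: ip_continuous_l.
Qed.

Lemma shift_coordS x n : ip (S x) (e n.+1) = (w n)%:C * ip x (e n).
Proof.
pose f y := ip (S y) (e n.+1) - (w n)%:C * ip y (e n).
apply/eqP; rewrite -subr_eq0; apply/eqP.
apply: (dense_closed_setT He.2 (A := [set x | f x = 0])); rewrite /f.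
  apply: lin_span_ind => /= [|a y z y0 z0|k].
  - by rewrite linear0 !linear0l mulr0 subr0.
  - rewrite linearP !linearDl !linearZl_LR /=.
    rewrite (_ : _ - _ = a * f y + f z); last by rewrite /f; ring.
    by rewrite /f y0 z0 mulr0 addr0.
  - rewrite HS.2 linearZl_LR /= !He.1 eqSS.
    by have [->|] := eqVneq k n; rewrite ?subrr// !mulr0 subrr.
apply: closed_zeros => y; apply: cvgB; last first.
  by apply: cvgMr; exact: ip_continuous_l.
apply: (@continuous_comp _ _ _ S (fun z => ip z (e n.+1) : R[i]^o)).
  exact: bounded_operator_continuous HS.1 _.
exact: ip_continuous_l.
Qed.

(** The coordinates of an eigenvector vanish one after the other: [l x_0 = 0]
    and [l x_n.+1 = w_n x_n]. *)
Lemma shift_no_eigenvalue (l : R[i]^o) x : l != 0 -> S x = l *: x -> x = 0.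
Proof.
move=> l0 Sx; apply: coord_inj.
have lz (z : R[i]) : l * z = 0 -> z = 0 by move=> /eqP; rewrite mulf_eq0 (negPf l0) => /eqP.
elim=> [|n IH]; apply: lz.
  by rewrite -(shift_coord0 x) Sx linearZl_LR.
by have := shift_coordS x n; rewrite IH mulr0 Sx linearZl_LR.
Qed.

Lemma shift_iter k n : iter k S (e n) = (\prod_(i < k) w (n + i))%:C *: e (n + k)%N.
Proof.
elim: k => [|k IH]; first by rewrite big_ord0 addn0 scale1r.
by rewrite iterS IH linearZ_LR /= HS.2 scalerA big_ord_recr addnS -rmorphM.
Qed.

Lemma rnorm_basis n : rnorm (e n) = 1.
Proof.
apply/eqP; rewrite -(@eqrXn2 _ 2%N)// ?rnorm_ge0// expr1n.
by apply/eqP/complexI; rewrite -dot_rnormE He.1 eqxx.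
Qed.

End HilbertShift.

(** * Weight products and their upper limit *)
Section Limsup.
Variables (R : realType) (w : nat -> R) (w_gt0 : forall n, 0 < w n).

Lemma weight_prod_gt0 n : 0 < weight_prod w n.
Proof. by apply: prodr_gt0. Qed.

Lemma weight_prod_powR n : (0 < n)%N ->
  (weight_prod w n `^ n%:R^-1) ^+ n = weight_prod w n.
Proof.
move=> n0; rewrite -powR_mulrn ?powR_ge0// -powRrM mulVf ?powRr1//.
  exact/ltW/weight_prod_gt0.
by rewrite pnatr_eq0 -lt0n.
Qed.

Lemma r3_ge0 : (0 <= r3 w)%E.
Proof.
apply: limf_esup_ge0 => [[N _ /(_ N (leqnn N))]//|n].
by rewrite lee_fin powR_ge0.
Qed.

(** The bound holds with constant 1 for large [n]; the constant absorbs the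
    finitely many other indices. *)
Lemma r3_lt_weight_prod (rho : R) : (r3 w < rho%:E)%E ->
  exists C, forall n, weight_prod w n <= C * rho ^+ n.
Proof.
rewrite /r3 /limn_esup limf_esupE => /ereal_inf_lt[_ [V [N _ NV] <-] Vrho].
have ltrho n : (N <= n)%N -> weight_prod w n `^ n%:R^-1 < rho.
  move=> Nn; rewrite -lte_fin; apply: le_lt_trans Vrho.
  by apply: ereal_sup_ubound; exists n => //; exact: NV.
have rho0 : 0 < rho by exact: le_lt_trans (powR_ge0 _ _) (ltrho N (leqnn N)).
pose c n := weight_prod w n / rho ^+ n.
have c0 n : 0 <= c n by rewrite divr_ge0 ?exprn_ge0 ?ltW ?weight_prod_gt0.
have sum0 : 0 <= \sum_(i < N.+1) c i by exact: sumr_ge0.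
exists (1 + \sum_(i < N.+1) c i) => n; rewrite -ler_pdivrMr ?exprn_gt0// -/(c n).
have [nN|Nn] := ltnP n N.+1.
  rewrite (bigD1 (Ordinal nN)) //= addrCA lerDl addr_ge0// sumr_ge0//.
apply: (@le_trans _ _ 1); last by rewrite lerDl.
rewrite /c ler_pdivrMr ?exprn_gt0// mul1r -weight_prod_powR ?(leq_trans _ Nn)//.
by rewrite lerXn2r ?nnegrE ?powR_ge0 ?(ltW rho0)// ltW// ltrho// ltnW.
Qed.

(** The gap between [t] and [s] absorbs the constant: [C * (t / s) ^+ n <= 1]
    for large [n]. *)
Lemma weight_prod_le_r3 (C t s : R) : 0 < t -> t < s ->
  (forall n, weight_prod w n <= C * t ^+ n) -> (r3 w <= s%:E)%E.
Proof.
move=> t0 ts wC; have s0 : 0 < s by exact: lt_trans ts.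
have : geometric C (t / s) @ \oo --> 0.
  by apply: cvg_geometric; rewrite ger0_norm ?divr_ge0 ?ltW// ltr_pdivrMr// mul1r.
move=> /cvgrPdist_lt/(_ _ ltr01)[N _ NC].
rewrite /r3 /limn_esup limf_esupE; apply: ge_ereal_inf.
exists (ereal_sup [set (weight_prod w n `^ n%:R^-1)%:E |
                   n in [set n | (N.+1 <= n)%N]]).
  by exists [set n | (N.+1 <= n)%N] => //; exists N.+1.
apply: ge_ereal_sup => _ [n /= Nn <-]; rewrite lee_fin.
have n0 : (0 < n)%N by exact: leq_ltn_trans Nn.
rewrite -(@ler_pXn2r _ n)// ?nnegrE ?powR_ge0 ?(ltW s0)// weight_prod_powR//.
rewrite (le_trans (wC n))// -[leRHS]mul1r -ler_pdivrMr ?exprn_gt0//.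
have := NC n (ltnW Nn); rewrite /geometric /= sub0r normrN expr_div_n mulrA => /ltW.
exact/le_trans/ler_norm.
Qed.

End Limsup.

(** * The spectrum of the shift *)
Section ShiftSpectrum.
Variables (R : realType) (H : completeNormedModType R[i]).
Variables (ip : {dot H for @Num.conj R[i]}) (Hip : hilbert_product ip).
Variables (e : nat -> H) (He : orthonormal_basis ip e).
Variables (w : nat -> R) (w_gt0 : forall n, 0 < w n).
Variables (S : {linear H -> H}) (HS : weighted_shift e w S).
Implicit Types x y : H.

(** For [l != 0] this formula and the next one determine the coordinates of [x]
    recursively from those of [S x - l *: x]. *)
Lemma shift_preimage_coord0 (l : R[i]^o) x : - l * ip x (e 0) = ip (S x - l *: x) (e 0).
Proof. by rewrite linearBl linearZl_LR /= (shift_coord0 Hip He HS) sub0r mulNr. Qed.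

Lemma shift_preimage_coordS (l : R[i]^o) x n :
  (w n)%:C * ip x (e n) - l * ip x (e n.+1) = ip (S x - l *: x) (e n.+1).
Proof. by rewrite linearBl linearZl_LR /= (shift_coordS Hip He HS). Qed.

(** A substitute for the closed graph theorem: [|G y| <= M] means that
    [|ip (G y) u| <= M |u|] for all [u] in the dense span of the basis, which is an
    intersection of closed conditions on [y]. *)
Lemma bounded_of_weakly_continuous (G : {linear H -> H}) :
  (forall n, continuous (fun y => ip (G y) (e n) : R[i]^o)) -> bounded_operator G.
Proof.
move=> cG; apply: closed_sublevel_bounded => M.
have [M0|M0] := ltP M 0.
  have -> : [set y | rnorm (G y) <= M] = set0.
    by apply/seteqP; split=> [y /= GM|y []]; have := rnorm_ge0 (G y); lra.
  exact: closed0.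
have -> : [set y | rnorm (G y) <= M] = \bigcap_(u in lin_span e)
    [set y | rnorm (ip (G y) u : R[i]^o) <= M * rnorm u].
  apply/seteqP; split=> y /= GM.
    by move=> u _ /=; rewrite (le_trans (cauchy_schwarz Hip _ _))// ler_wpM2r ?rnorm_ge0.
  have : rnorm (ip (G y) (G y) : R[i]^o) <= M * rnorm (G y).
    pose A := [set u | rnorm (ip (G y) u : R[i]^o) <= M * rnorm u].
    apply: (dense_closed_setT He.2 (A := A)) => //.
    by apply: (closed_rnorm_le (g := id)); [exact: ip_continuous_r|move=> z; exact: cvg_id].
  rewrite (dot_rnormE Hip) rnorm_real ?sqr_ge0// expr2.
  have [->|G0] := eqVneq (rnorm (G y)) 0; first by [].
  by rewrite ler_pM2r// lt_def G0 rnorm_ge0.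
apply: closed_bigI => u uspan.
apply: (@closed_rnorm_le _ _ _ _ _ (fun=> u)); last exact: cst_continuous.
move: u uspan; apply: lin_span_ind => /= [|a u v cu cv|n]; last exact: cG.
- by under eq_fun do rewrite linear0r; exact: cst_continuous.
- under eq_fun do rewrite linearDr linearZr_LR /=.
  by move=> y; apply: cvgD; [apply: cvgMr; exact: cu|exact: cv].
Qed.

(** Bijectivity suffices: each coordinate of the inverse is a finite linear
    combination of continuous coordinate functionals, by the recursion on
    coordinates, so the inverse is bounded. *)
Lemma shift_resolvent_set (l : R[i]^o) : l != 0 ->
  (forall y, exists x, S x - l *: x = y) -> resolvent_set S l.
Proof.
move=> l0 /choice[g gE].
have inj x y : S x - l *: x = S y - l *: y -> x = y.
  move=> xy; apply/subr0_eq/(shift_no_eigenvalue Hip He HS l0)/subr0_eq.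
  rewrite [S _]linearB scalerBr opprD addrACA -opprD xy.
  exact: subrr.
have glin : linear g.
  move=> a x y; apply: inj; rewrite gE.
  have -> : S (a *: g x + g y) - l *: (a *: g x + g y) =
      a *: (S (g x) - l *: g x) + (S (g y) - l *: g y).
    have -> : S (a *: g x + g y) = a *: S (g x) + S (g y) by exact: linearP.
    by rewrite scalerDr scalerBr opprD addrACA !scalerA [l * a]mulrC.
  by rewrite !gE.
pose G : {linear H -> H} := HB.pack g (GRing.isLinear.Build _ _ _ _ g glin).
exists G; split; last by move=> x; split; [apply: inj; rewrite gE|exact: gE].
apply: bounded_of_weakly_continuous; elim=> [|n IH].
  have -> : (fun y => ip (G y) (e 0)) = (fun y => - l^-1 * ip y (e 0)).
    apply/funext => y; rewrite -{2}(gE y) -shift_preimage_coord0 mulrA.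
    by rewrite mulrNN mulVf// mul1r.
  by move=> y; apply: cvgMr; exact: (ip_continuous_l Hip).
have -> : (fun y => ip (G y) (e n.+1)) =
    (fun y => l^-1 * ((w n)%:C * ip (G y) (e n) - ip y (e n.+1))).
  apply/funext => y; rewrite -{3}(gE y) -shift_preimage_coordS opprB addrC subrK.
  by rewrite mulrA mulVf// mul1r.
move=> y; apply: cvgMr; apply: cvgB; first by apply: cvgMr; exact: IH.
exact: (ip_continuous_l Hip).
Qed.

Lemma span_geometric_orbit (C rho : R) x :
  (forall n, weight_prod w n <= C * rho ^+ n) -> lin_span e x ->
  exists D, forall k, rnorm (iter k S x) <= D * rho ^+ k.
Proof.
move=> wC; move: x; apply: lin_span_ind => /= [|a x y [D xD] [D' yD]|n].
- exists 0 => k; rewrite mul0r (_ : iter k S 0 = 0) ?rnorm0//.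
  by elim: k => //= k ->; exact: linear0.
- exists (rnorm (a : R[i]^o) * D + D') => k.
  have -> : iter k S (a *: x + y) = a *: iter k S x + iter k S y.
    by elim: k => //= k ->; exact: linearP.
  rewrite (le_trans (ler_rnormD _ _))// rnormZ mulrDl lerD//.
  by rewrite -mulrA ler_wpM2l ?rnorm_ge0.
- exists (C * rho ^+ n / weight_prod w n) => k.
  rewrite (shift_iter HS) rnormZ (rnorm_basis Hip He) mulr1.
  rewrite mulrAC ler_pdivlMr ?weight_prod_gt0//.
  rewrite rnorm_real; last by apply: prodr_ge0 => i _; exact: ltW.
  rewrite -mulrA -exprD; apply: le_trans (wC _).
  by rewrite /weight_prod big_split_ord /= mulrC.
Qed.

(** The heart of the matter. For [r3 w < rho < |l|] all vectors of the span have
    their local spectrum in the disk of radius [rho]; condition (C) extends this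
    to the closure of the span, which is [H]. So [l] lies in the local
    resolvent set of every vector and [S - l] is onto. *)
Lemma dunford_resolvent_set (l : R[i]^o) : dunford_condition_C S ->
  (r3 w < (rnorm l)%:E)%E -> resolvent_set S l.
Proof.
move=> dC rl.
have [rho rrho rhol] : exists2 rho, (r3 w < rho%:E)%E & rho < rnorm l.
  move: (r3_ge0 w) rl; case: (r3 w) => [r| |]//; rewrite !lte_fin => _ rl.
  by exists ((r + rnorm l) / 2); rewrite ?lte_fin; lra.
have rho0 : 0 < rho by rewrite -lte_fin (le_lt_trans (r3_ge0 w)).
have l0 : l != 0 by apply: contraTneq (lt_trans rho0 rhol) => ->; rewrite rnorm0 ltxx.
have [C wC] := r3_lt_weight_prod w_gt0 rrho.
have sub : forall x, local_spectral_subspace S [set l | rnorm l <= rho] x.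
  apply: dense_closed_setT He.2 _ (dC _ (@closed_disk _ _)).
  move=> x /(span_geometric_orbit wC)[D xD].
  apply: local_spectrum_geometric_orbit HS.1 (ltW rho0) _ xD.
  by move=> m z; apply: (shift_no_eigenvalue Hip He HS).
apply: shift_resolvent_set => // y.
have [U [_ [f [_ fE]]] Ul] : local_resolvent_set S y l.
  by apply: contrapT => /(sub y l) /=; rewrite leNgt rhol.
by exists (f l); exact: fE.
Qed.

(** No vector in the range of [S] has a component along [e 0]. This also
    excludes an empty spectrum, whose supremum would be [-oo]. *)
Lemma shift_spectrum0 : spectrum S 0.
Proof.
move=> [G [_ GE]]; have := (GE (e 0)).2; rewrite scale0r subr0 => SG.
have := shift_coord0 Hip He HS (G (e 0)); rewrite SG He.1 eqxx.
by move/eqP; rewrite oner_eq0.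
Qed.

(** The coordinates of [(S - t)^-1 e_0] are forced to be
    [- weight_prod w n / t ^+ n.+1], and they are bounded by its norm. *)
Lemma resolvent_weight_prod (t : R) : 0 < t -> resolvent_set S t%:C ->
  exists C, forall n, weight_prod w n <= C * t ^+ n.
Proof.
move=> t0 [G [_ GE]]; pose x := G (e 0); have xE := (GE (e 0)).2.
have tn : rnorm (t%:C : R[i]^o) = t := rnorm_real (ltW t0).
have t0' : t%:C != 0 :> R[i] by rewrite lt0r_neq0 ?ltcR.
exists (rnorm x * t) => n.
have xn : ip x (e n) = - (weight_prod w n / t ^+ n.+1)%:C.
  elim: n => [|n IH].
    have := shift_preimage_coord0 t%:C x; rewrite xE He.1 eqxx.
    rewrite /weight_prod big_ord0 expr1 mul1r fmorphV mulNr => /(canRL (@opprK _)) xE'.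
    by apply: (mulfI t0'); rewrite xE' mulrN divff.
  have := shift_preimage_coordS t%:C x n; rewrite xE He.1 /= => /subr0_eq.
  rewrite IH => xE'; apply: (mulfI t0'); rewrite -xE' /weight_prod big_ord_recr /=.
  rewrite !mulrN -!rmorphM /=; congr (- (_%:C)).
  by rewrite [t ^+ n.+2]exprS; field; rewrite !gt_eqF ?exprn_gt0.
have := cauchy_schwarz Hip x (e n); rewrite xn rnormN (rnorm_basis Hip He) mulr1.
have c0 : 0 <= weight_prod w n / t ^+ n.+1.
  by rewrite divr_ge0 ?exprn_ge0 ?(ltW t0)// ltW ?weight_prod_gt0.
rewrite rnorm_real//.
by rewrite ler_pdivrMr ?exprn_gt0// exprS mulrA.
Qed.

End ShiftSpectrum.

Theorem theorem3p7 (R : realType) (H : completeNormedModType R[i])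
  (ip : {dot H for @Num.conj R[i]}) (Hip : hilbert_product ip)
  (e : nat -> H) (He : orthonormal_basis ip e)
  (w : nat -> R) (w_gt0 : forall n, 0 < w n)
  (w_bounded : exists M : R, forall n, w n <= M)
  (S : {linear H -> H}) (HS : weighted_shift e w S) :
  dunford_condition_C S -> spectral_radius S = r3 w.
Proof.
move=> dC; apply/eqP; rewrite eq_le; apply/andP; split.
  apply: ge_ereal_sup => _ [l sl <-]; rewrite leNgt; apply/negP => rl.
  exact/sl/(dunford_resolvent_set Hip He w_gt0 HS dC).
have r0 : (0 <= spectral_radius S)%E.
  apply: ereal_sup_ubound; exists (0 : R[i]^o); first exact: (shift_spectrum0 Hip He HS).
  by rewrite normr0.
apply/lee_addgt0Pr => d d0.
have : forall l : R[i]^o, spectrum S l -> ((rnorm l)%:E <= spectral_radius S)%E.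
  by move=> l sl; apply: ereal_sup_ubound; exists l.
case: (spectral_radius S) r0 => [r| |]//; last by move=> _ _; exact: leey.
rewrite lee_fin => r0 rS; rewrite -EFinD.
have t0 : 0 < r + d / 2 by lra.
have [C wC] : exists C, forall n, weight_prod w n <= C * (r + d / 2) ^+ n.
  apply: (resolvent_weight_prod Hip He w_gt0 HS) => //; apply: contrapT => /rS.
  by rewrite lee_fin rnorm_real ?(ltW t0)// => ?; lra.
by apply: (weight_prod_le_r3 w_gt0 t0 _ wC); lra.
Qed.
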